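(* Let $\mu_n$ and $\sigma_n^2$ (with $\sigma_n\ge0$) be the expected value and the variance of the random variable $X_n$. Then $$A_{n,k}\sim F_{2n}\,\frac{\phi(x)}{\sigma_n}\qquad\text{for } n\to\infty,$$ where $k=\mu_n+x\sigma_n$ and $x$ is bounded. That is, for every sequence of integers $(k_n)_{n\ge2}$ such that $x_n:=(k_n-\mu_n)/\sigma_n$ is a bounded sequence, $\dfrac{A_{n,k_n}\,\sigma_n}{F_{2n}\,\phi(x_n)}\to1$ as $n\to\infty$.
   Context: The polynomials $Q_n(x)$ are defined by $Q_0(x)=1$ and $Q_n(x)=x\sum_{k=1}^n k\,Q_{n-k}(x)$ for $n\ge 1$. The numbers $A_{n,k}$ are their coefficients: $Q_n(x)=\sum_{k=0}^n A_{n,k}x^k$. For $n\ge1$ and $0\le k\le n$ one has $A_{n,k}=\binom{n+k-1}{2k-1}$, with $A_{n,0}=0$; for integers $k<0$ or $k>n$ set $A_{n,k}=0$. For $n\ge1$, $X_n$ is a random variable with values in $\{0,1,\dots,n\}$ and $P(X_n=k)=A_{n,k}/\sum_{m=0}^n A_{n,m}$. The function $\phi(x)=\frac{1}{\sqrt{2\pi}}e^{-x^2/2}$ is the standard normal density. $F_n$ denotes the Fibonacci numbers, $F_0=0$, $F_1=1$, $F_n=F_{n-1}+F_{n-2}$. *)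

(* Defs.v *)
From HB Require Import structures.
From mathcomp Require Import all_boot all_order all_algebra.
From mathcomp Require Import all_classical all_reals all_analysis.

Set Implicit Arguments.
Unset Strict Implicit.
Unset Printing Implicit Defensive.

Import Order.TTheory GRing.Theory Num.Theory.
Import numFieldNormedType.Exports.

Local Open Scope ring_scope.

(* Course-of-values recursion: [Qlist n] is [:: Q_0; ...; Q_n]. *)
Fixpoint Qlist (n : nat) : seq {poly int} :=
  if n is m.+1 then
    rcons (Qlist m)
      ('X * \sum_(1 <= k < m.+2) (Qlist m)`_(m.+1 - k) *+ k)
  else [:: 1].

Definition Q (n : nat) : {poly int} := (Qlist n)`_n.

Lemma size_Qlist n : size (Qlist n) = n.+1.
Proof. by elim: n => //= n IHn; rewrite size_rcons IHn. Qed.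

Lemma nth_Qlist n i : (i <= n)%N -> (Qlist n)`_i = Q i.
Proof.
elim: n => [|n IHn]; first by rewrite leqn0 => /eqP ->.
rewrite leq_eqVlt => /predU1P[-> //|]; rewrite ltnS => le_in.
by rewrite /= nth_rcons size_Qlist ltnS le_in IHn.
Qed.

Lemma Q0 : Q 0 = 1.
Proof. by []. Qed.

Lemma Q_rec n : (1 <= n)%N ->
  Q n = 'X * \sum_(1 <= k < n.+1) Q (n - k) *+ k.
Proof.
case: n => // n _; rewrite {1}/Q /= nth_rcons size_Qlist ltnn eqxx.
congr (_ * _); apply: eq_big_nat => k /andP[k_gt0 _].
by rewrite nth_Qlist // leq_subLR -add1n leq_add2r.
Qed.

Definition A (n : nat) (k : int) : int :=
  if (0 <= k) && (k <= n%:Z) then (Q n)`_(`|k|%N) else 0.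

Fixpoint fib (n : nat) : nat :=
  match n with
  | 0 => 0%N
  | 1 => 1%N
  | (m.+1 as p).+1 => (fib p + fib m)%N
  end.

Definition phi (R : realType) (x : R) : R :=
  (Num.sqrt (2 * pi))^-1 * expR (- (x ^+ 2) / 2).

Definition has_coef_law (R : realType) (d : measure_display)
    (T : measurableType d) (P : probability T R) (X : {RV P >-> R})
    (n : nat) : Prop :=
  (forall w : T, exists2 k : nat, (k <= n)%N & X w = k%:R) /\
  (forall k : nat, (k <= n)%N ->
     pmf X k%:R = (A n k%:Z)%:~R / \sum_(0 <= m < n.+1) (A n m%:Z)%:~R).

(* [fine] loses nothing for variables satisfying [has_coef_law]: they are
   bounded, so their expectation and variance are finite. *)
Definition mean (R : realType) (d : measure_display)
    (T : measurableType d) (P : probability T R) (X : {RV P >-> R}) : R :=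
  fine 'E_P[X].

Definition stddev (R : realType) (d : measure_display)
    (T : measurableType d) (P : probability T R) (X : {RV P >-> R}) : R :=
  Num.sqrt (fine 'V_P[X]).

(* Main.v *)
Require Import Defs.
From HB Require Import structures.
From mathcomp Require Import all_boot all_order all_algebra.
From mathcomp Require Import all_classical all_reals all_analysis.
From mathcomp Require Import ring lra zify.

Import Order.TTheory GRing.Theory Num.Theory.
Import numFieldNormedType.Exports.

Local Open Scope classical_set_scope.
Local Open Scope ring_scope.

(** Write a_k for the coefficient A_{n,k}, F for F_{2n}, and mu, sigma for the
    mean and standard deviation of X_n.  The proof rests on the ratio of two
    consecutive coefficients,
<<
      2k (2k+1) a_{k+1} = (n^2 - k^2) a_k,
>>
    which is used twice.

    Exactly: summed over k, it gives 5 E[X^2] - 6 E[X] + 2 = n^2, so the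
    variance is determined by the mean.  The mean is Q_n'(1) / Q_n(1), and
    both values follow from the three-term recurrence
    Q_{n+2} = (2+x) Q_{n+1} - Q_n; the result is
    mu = n L / (5F) + 2/5, with L the Lucas number L_{2n}.
    As L^2 = 5 F^2 + 4, the quotient L/F is exponentially close to sqrt 5.
    So with tau = n / sqrt 5 both mu - tau and sigma^2 - (2/5) tau stay
    bounded ([coef_law_mean_close], [coef_law_variance_close]).

    Asymptotically: at k = tau + h with h = O(sqrt n) the logarithm of the
    ratio is -5h/(2 tau) + O(1/n) = -(k - mu)/sigma^2 + O(1/n)
    ([ln_ratio_close], [ln_coef_Q_ratio_close]).  This is also, up to O(1/n),
    the logarithmic increment of phi((k - mu)/sigma).  A window of width
    O(sigma) about mu has O(sqrt n) terms, so over it the quotient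
    a_k / phi((k - mu)/sigma) is constant up to a factor 1 + o(1).

    Only that constant remains to be found.  By Chebyshev's inequality the a_k
    of the window |k - mu| <= K sigma add up to F (1 - O(1/K^2))
    ([chebyshev_window]), while the values of phi there, divided by sigma, form a Riemann sum of the Gaussian integral over
    [-K, K] ([phi_window_sum]).  Hence the constant is F / sigma, up to an
    error that vanishes when n and then K tend to infinity.  This last part
    makes sense for any array of nonnegative numbers and is stated so in
    [local_limit_of_ratio]. *)

(** * The coefficients of Q_n *)

(** First difference in n of Q_n = x S_n, where S_n = sum_j (n - j) Q_j: each
    coefficient n - j grows by one.  The case n = 0 is separate because
    Q_0 = 1 is not a multiple of x. *)
Lemma Q_partial_sums n :
  'X * \sum_(j < n.+1) Q j = Q n.+1 - (if n is 0 then 0 else Q n).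
Proof.
have QE m : Q m.+1 = 'X * \sum_(j < m.+1) Q j *+ (m.+1 - j).
  rewrite Q_rec // big_add1 big_mkord (reindex_inj rev_ord_inj) /=.
  congr (_ * _); apply: eq_bigr => j _; have jm := ltn_ord j.
  rewrite (_ : m.+1 - _ = j)%N; last by rewrite /=; lia.
  by congr (_ *+ _); rewrite /=; lia.
case: n => [|n]; first by rewrite QE !big_ord1 subr0.
rewrite !QE -mulrBr; congr (_ * _).
rewrite big_ord_recr [in RHS]big_ord_recr /= subSnn mulr1n addrAC -sumrB.
congr (_ + _); apply: eq_bigr => j _; have jn := ltn_ord j.
rewrite -mulrnBr ?leq_sub2r //.
by rewrite subSn ?subSnn // ltnW.
Qed.

(** Second difference of S_n.  It starts at index 1, since Q_0 would have to be
    0 for the recurrence to extend to it. *)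
Lemma Q_three_term n : Q n.+3 = (2 + 'X) * Q n.+2 - Q n.+1.
Proof.
have := Q_partial_sums n.+2; have := Q_partial_sums n.+1.
rewrite [in X in _ -> X]big_ord_recr /= mulrDr => -> H.
apply/eqP; rewrite -subr_eq0; apply/eqP.
have -> : Q n.+3 = (Q n.+3 - Q n.+2) + Q n.+2 by rewrite subrK.
by rewrite -H; ring.
Qed.

Lemma Q1E : Q 1 = 'X.
Proof. by rewrite Q_rec // big_nat1 Q0 mulr1. Qed.

Lemma Q2E : Q 2 = (2 + 'X) * 'X.
Proof.
by rewrite Q_rec // big_nat_recr //= big_nat1 Q0 Q1E; ring.
Qed.

Lemma bin_second_difference m j :
  ('C(m.+2, j.+2) + 'C(m, j.+2) = 2 * 'C(m.+1, j.+2) + 'C(m, j))%N.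
Proof. by rewrite !binS; lia. Qed.

Lemma coef_Q n k : (Q n.+1)`_k = if k is j.+1 then 'C(n + k, (2 * j).+1)%:Z else 0.
Proof.
have [m le_nm] := ubnP n; elim: m => // m IHm in n k le_nm *.
case: n le_nm => [|[|n]] le_nm.
- rewrite Q1E coefX; case: k => [|[|k]] //.
  by rewrite add0n bin_small //; lia.
- rewrite Q2E mulrDl coefD coefXM coefX mulr_natl coefMn coefX.
  case: k => [|[|[|k]]] //=; first by rewrite bin_small //; lia.
- rewrite Q_three_term mulrDl coefB coefD coefXM mulr_natl coefMn.
  rewrite !IHm; [|lia..].
  case: k => [|[|k]] //=.
    by rewrite muln0 !bin1; lia.
  have := bin_second_difference (n + k).+2 (2 * k).+1.
  rewrite (_ : (2 * k.+1).+1 = (2 * k).+1.+2)%N; last by lia.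
  by rewrite !addSn !addnS; lia.
Qed.

(** The ratio of consecutive coefficients, free of divisions so that it also
    holds at k = 0 and beyond k = n, where both sides vanish. *)
Lemma ratio_coef_Q n k :
  ((2 * k) * (2 * k).+1)%N%:Z * (Q n.+1)`_k.+1 =
    (n.+1%:Z ^+ 2 - k%:Z ^+ 2) * (Q n.+1)`_k.
Proof.
rewrite !coef_Q; case: k => [|k]; first by rewrite mulr0 mul0r.
have diag := mul_bin_diag (n + k.+2) (2 * k).+2.
have left := mul_bin_left (n + k.+1) (2 * k).+1.
rewrite (_ : 2 * k.+1 = (2 * k).+2)%N; last by lia.
rewrite (addnS n k.+1) /= -addnS in diag.
have -> : n.+1%:Z ^+ 2 - k.+1%:Z ^+ 2 = (n + k.+2)%N%:Z * (n%:Z - k%:Z).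
  by rewrite !PoszD !intS; ring.
have leftZ : (2 * k).+2%:Z * 'C(n + k.+1, (2 * k).+2)%:Z =
    (n%:Z - k%:Z) * 'C(n + k.+1, (2 * k).+1)%:Z.
  have [le_kn|lt_nk] := leqP k n.
    by rewrite -PoszM left subzn // -PoszM; congr (_ * _)%N%:Z; lia.
  by rewrite !bin_small ?mulr0 //; lia.
rewrite -[RHS]mulrA -leftZ [RHS]mulrCA -[in RHS]PoszM diag !PoszM; ring.
Qed.

Lemma size_Q n : (size (Q n.+1) <= n.+2)%N.
Proof.
apply/leq_sizeP => -[|j] // lt_nj.
by rewrite coef_Q bin_small //; lia.
Qed.

Lemma A_coef n k : A n.+1 k%:Z = (Q n.+1)`_k.
Proof.
rewrite /A lez_nat /=; case: ifP => // /negbT; rewrite -ltnNge => lt_nk.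
by rewrite (leq_sizeP _ _ (size_Q n)).
Qed.

Lemma coef_Q_ge0 n k : 0 <= (Q n)`_k.
Proof.
by case: n => [|n]; [rewrite Q0 coef1 | rewrite coef_Q; case: k].
Qed.

Lemma coef_Q_gt0 n k : (0 < k <= n.+1)%N -> 0 < (Q n.+1)`_k.
Proof.
by case: k => // k le_kn; rewrite coef_Q ltz_nat bin_gt0; lia.
Qed.

(** * Fibonacci and Lucas numbers *)

Lemma fibSS n : fib n.+2 = (fib n.+1 + fib n)%N.
Proof. by []. Qed.

Lemma fib_even_succ n : fib (2 * n.+1) = (fib (2 * n).+1 + fib (2 * n))%N.
Proof. by rewrite (_ : 2 * n.+1 = (2 * n).+2)%N //; lia. Qed.

Lemma fib_odd_succ n :
  fib (2 * n.+1).+1 = (2 * fib (2 * n).+1 + fib (2 * n))%N.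
Proof.
rewrite (_ : (2 * n.+1).+1 = (2 * n).+3)%N; last by lia.
by rewrite !fibSS; lia.
Qed.

(** The Lucas number L_{2n} = F_{2n+1} + F_{2n-1}, written without the index
    2n - 1. *)
Definition lucas_even n : int := 2 * (fib (2 * n).+1)%:Z - (fib (2 * n))%:Z.

Lemma lucas_evenS n :
  2 * lucas_even n.+1 = 3 * lucas_even n + 5 * (fib (2 * n))%:Z.
Proof. by rewrite /lucas_even fib_even_succ fib_odd_succ; lia. Qed.

Lemma fib_evenS n :
  2 * (fib (2 * n.+1))%:Z = 3 * (fib (2 * n))%:Z + lucas_even n.
Proof. by rewrite /lucas_even fib_even_succ; lia. Qed.

(** The case of even index of L_m^2 = 5 F_m^2 + 4 (-1)^m. *)
Lemma lucas_even_sqr n :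
  lucas_even n ^+ 2 = 5 * (fib (2 * n))%:Z ^+ 2 + 4.
Proof.
elim: n => // n; have := lucas_evenS n; have := fib_evenS n.
move: (lucas_even n) (lucas_even n.+1) (fib _)%:Z (fib _)%:Z => l l' f' f; nia.
Qed.

Lemma fib_even_ge n : (n <= fib (2 * n))%N.
Proof.
suff: (n <= fib (2 * n))%N /\ (0 < fib (2 * n).+1)%N by case.
by elim: n => // n [IH1 IH2]; rewrite fib_even_succ fib_odd_succ; lia.
Qed.

Lemma sqrt5_bounds {R : realType} : 2 <= Num.sqrt (5 : R) <= 3.
Proof.
have q0 : 0 <= Num.sqrt 5 :> R by rewrite sqrtr_ge0.
by apply/andP; split; rewrite -ler_sqr ?nnegrE // sqr_sqrtr //; lra.
Qed.

(** (r - sqrt 5)(r + sqrt 5) = 4 / F^2 for r = L/F, and r + sqrt 5 >= 4. *)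
Lemma lucas_fib_ratio {R : realType} n :
  Num.sqrt (5 : R) <= (lucas_even n.+1)%:~R / (fib (2 * n.+1))%:R
    <= Num.sqrt (5 : R) + (fib (2 * n.+1))%:R ^- 2.
Proof.
set F : R := (fib _)%:R; set L := (lucas_even n.+1)%:~R : R.
have /andP[q2 q3] := @sqrt5_bounds R.
have F0 : 0 < F by rewrite ltr0n (leq_trans _ (fib_even_ge _)).
have L0 : 0 <= L.
  by rewrite ler0z /lucas_even fib_even_succ fib_odd_succ; lia.
have L2 : L ^+ 2 = 5 * F ^+ 2 + 4.
  have := congr1 (intmul (1 : R)) (lucas_even_sqr n.+1).
  by rewrite rmorphXn => ->; rewrite /F; ring.
have r0 : 0 <= L / F by rewrite divr_ge0 // ltW.
have r2 : (L / F) ^+ 2 = 5 + 4 / F ^+ 2.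
  by rewrite expr_div_n L2; field; rewrite gt_eqF.
have q5 : (Num.sqrt 5 : R) ^+ 2 = 5 by rewrite sqr_sqrtr.
have f0 : 0 < (F ^+ 2)^-1 by rewrite invr_gt0 exprn_gt0.
apply/andP; split.
  by rewrite -ler_sqr ?nnegrE ?sqrtr_ge0 // r2 q5 lerDl mulr_ge0 // ltW.
rewrite -ler_sqr ?nnegrE ?addr_ge0 ?sqrtr_ge0 ?(ltW f0) // r2 sqrrD q5.
have : 2 * (F ^+ 2)^-1 <= Num.sqrt 5 * (F ^+ 2)^-1 by rewrite ler_wpM2r // ltW.
have := sqr_ge0 (F ^+ 2)^-1; lra.
Qed.

(** * Power sums of the coefficients *)

Lemma Q_at1 n : (Q n.+1).[1] = (fib (2 * n.+1))%:Z.
Proof.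
suff: (Q n.+1).[1] = (fib (2 * n.+1))%:Z /\ (Q n.+2).[1] = (fib (2 * n.+2))%:Z
  by case.
elim: n => [|n [IH1 IH2]]; first by rewrite Q1E Q2E !hornerE.
split=> //; rewrite Q_three_term !hornerE IH1 IH2.
by rewrite !fib_even_succ !fib_odd_succ !fib_even_succ; lia.
Qed.

(** With 2 cosh t = 2 + x one has Q_n = x sinh(nt) / sinh(t); differentiating
    at x = 1 gives this closed form.  Once it is known, the differentiated
    three-term recurrence proves it by induction. *)
Lemma deriv_Q_at1 n :
  5 * (Q n.+1)^`().[1] = n.+1%:Z * lucas_even n.+1 + 2 * (fib (2 * n.+1))%:Z.
Proof.
suff: 5 * (Q n.+1)^`().[1] =
    n.+1%:Z * lucas_even n.+1 + 2 * (fib (2 * n.+1))%:Z /\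
  5 * (Q n.+2)^`().[1] =
    n.+2%:Z * lucas_even n.+2 + 2 * (fib (2 * n.+2))%:Z by case.
elim: n => [|n [IH1 IH2]].
  by rewrite Q1E Q2E !poly.derivE !hornerE.
split=> //; rewrite Q_three_term !poly.derivE !hornerE Q_at1 mulrBr mulrDr.
rewrite mulrCA IH1 IH2 /lucas_even.
rewrite !(fib_even_succ n.+2, fib_odd_succ n.+2).
rewrite !(fib_even_succ n.+1, fib_odd_succ n.+1).
rewrite !(PoszD, PoszM) !intS; ring.
Qed.

Lemma sum_coef_Q n : \sum_(k < n.+2) (Q n.+1)`_k = (fib (2 * n.+1))%:Z.
Proof.
rewrite -Q_at1 (horner_coef_wide _ (size_Q n)).
by apply: eq_bigr => k _; rewrite expr1n mulr1.
Qed.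

Lemma sum_id_coef_Q n :
  5 * \sum_(k < n.+2) k%:Z * (Q n.+1)`_k =
    n.+1%:Z * lucas_even n.+1 + 2 * (fib (2 * n.+1))%:Z.
Proof.
rewrite -deriv_Q_at1; congr (_ * _).
have szd : (size (Q n.+1)^`() <= n.+1)%N.
  by apply/leq_sizeP => j le_nj; rewrite coef_deriv (leq_sizeP _ _ (size_Q n)) ?mul0rn.
rewrite (horner_coef_wide _ szd) big_ord_recl mul0r add0r.
by apply: eq_bigr => k _; rewrite expr1n mulr1 coef_deriv -mulr_natl natz.
Qed.

(** The ratio identity says that the k-th term of
    sum_k [(2k-2)(2k-1) a_k - 2k(2k+1) a_{k+1}] equals
    (5k^2 - 6k + 2 - n^2) a_k, and this sum telescopes to 0. *)
Lemma sum_quadratic_coef_Q n :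
  \sum_(k < n.+2) (5 * k%:Z ^+ 2 - 6 * k%:Z + 2) * (Q n.+1)`_k =
    n.+1%:Z ^+ 2 * (fib (2 * n.+1))%:Z.
Proof.
pose g (j : nat) : int := (2 * j%:Z - 2) * (2 * j%:Z - 1) * (Q n.+1)`_j.
have shift : \sum_(k < n.+2) g k = \sum_(k < n.+2) g k.+1.
  rewrite [RHS]big_ord_recr [LHS]big_ord_recl /g /= coef_Q.
  by rewrite (leq_sizeP _ _ (size_Q n)) // !mulr0 add0r addr0.
rewrite -sum_coef_Q mulr_sumr; apply/eqP; rewrite -subr_eq0 -sumrB.
rewrite (eq_bigr (fun k : 'I_n.+2 => g k - g k.+1)); last first.
  move=> k _; rewrite {2}/g intS.
  have -> : (2 * (1 + k%:Z) - 2) * (2 * (1 + k%:Z) - 1) = ((2 * k) * (2 * k).+1)%N%:Z.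
    by rewrite !PoszM !intS !PoszM; ring.
  by rewrite ratio_coef_Q /g; ring.
by rewrite sumrB shift subrr.
Qed.

(** * Mean and variance of X_n *)

(** f(X) is the finite combination of the indicators of the events X = k with
    coefficients f(k). *)
Lemma expectation_finite_support {R : realType} {d : measure_display}
    {T : measurableType d} {P : probability T R} {X : {RV P >-> R}} {n : nat}
    (f : R -> R) :
  (forall w, exists2 k : nat, (k <= n)%N & X w = k%:R) ->
  'E_P[(f \o X)%FUN]%E = (\sum_(k < n.+1) f k%:R * pmf X k%:R)%:E.
Proof.
move=> supX; pose B (k : 'I_n.+1) : set T := X @^-1` [set k%:R].
have mB k : measurable (B k) by exact: measurable_sfunP.
pose Y (k : 'I_n.+1) : T -> R := (f k%:R \o* \1_(B k))%R.
have YL k : Y k \in Lfun P 1.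
  apply: Lfun_scale => //. apply/Lfun1_integrable. exact: integrable_indic.
have -> : (f \o X)%FUN = \sum_(Yk <- [seq Y k | k : 'I_n.+1]) Yk.
  apply/funext => w /=; rewrite big_image fct_sumE /=.
  have [k le_kn Xw] := supX w.
  rewrite (bigD1 (Ordinal (le_kn : (k < n.+1)%N))) //= Xw big1 ?addr0.
    by rewrite /Y /= indicE mem_set ?mul1r //.
  move=> j /eqP neq_jk; rewrite /Y /= indicE memNset ?mul0r // /B /= Xw => /eqP.
  by rewrite eqr_nat => /eqP eq_kj; apply: neq_jk; apply: val_inj.
rewrite expectation_sum => [|_ /mapP[k _ ->]//].
rewrite big_image /= -sumEFin; apply: eq_bigr => k _.
rewrite expectationZl; last by apply/Lfun1_integrable; exact: integrable_indic.
rewrite expectation_indic // EFinM; congr (_ * _)%E.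
by rewrite /pmf fineK // fin_num_measure.
Qed.

Lemma mean_finite_support {R : realType} {d : measure_display}
    {T : measurableType d} {P : probability T R} {X : {RV P >-> R}} {n : nat} :
  (forall w, exists2 k : nat, (k <= n)%N & X w = k%:R) ->
  mean X = \sum_(k < n.+1) k%:R * pmf X k%:R.
Proof. by move=> supX; rewrite /mean (expectation_finite_support id supX). Qed.

Lemma stddev_finite_support {R : realType} {d : measure_display}
    {T : measurableType d} {P : probability T R} {X : {RV P >-> R}} {n : nat} :
  (forall w, exists2 k : nat, (k <= n)%N & X w = k%:R) ->
  stddev X ^+ 2 = \sum_(k < n.+1) (k%:R - mean X) ^+ 2 * pmf X k%:R.
Proof.
move=> supX; rewrite /stddev sqr_sqrtr ?fine_ge0 ?variance_ge0 //.
rewrite /variance covariance.unlock.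
by rewrite -[RHS]/(fine _%:E)
     -(expectation_finite_support (fun r => (r - mean X) ^+ 2) supX).
Qed.

Section CoefLaw.
Context {R : realType} {d : measure_display} {T : measurableType d}.
Context {P : probability T R} {X : {RV P >-> R}} {n : nat}.
Context (lawX : has_coef_law X n.+1).

Let F : R := (fib (2 * n.+1))%:R.
Let L : R := (lucas_even n.+1)%:~R.

Let F_gt0 : 0 < F.
Proof. by rewrite ltr0n (leq_trans _ (fib_even_ge _)). Qed.

Let a (k : nat) : R := ((Q n.+1)`_k)%:~R.

Let sum_a : \sum_(k < n.+2) a k = F.
Proof. by rewrite -[F]/((fib _)%:Z%:~R) -sum_coef_Q rmorph_sum. Qed.

Let sum_id_a : \sum_(k < n.+2) k%:R * a k = (n.+1%:R * L + 2 * F) / 5.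
Proof.
have e : 5 * \sum_(k < n.+2) k%:R * a k = n.+1%:R * L + 2 * F.
  have := congr1 (intmul (1 : R)) (sum_id_coef_Q n).
  rewrite rmorphM [X in _ = X -> _]rmorphD.
  rewrite [X in _ = X + _ -> _]rmorphM [X in _ = _ + X -> _]rmorphM.
  rewrite [X in _ * X]rmorph_sum => <-; congr (_ * _).
  by apply: eq_bigr => k _; rewrite rmorphM.
by rewrite -e mulrC mulKf.
Qed.

Let sum_quadratic_a :
  \sum_(k < n.+2) (5 * k%:R ^+ 2 - 6 * k%:R + 2) * a k = n.+1%:R ^+ 2 * F.
Proof.
have := congr1 (intmul (1 : R)) (sum_quadratic_coef_Q n).
rewrite rmorph_sum rmorphM rmorphXn => <-.
by apply: eq_bigr => k _; rewrite rmorphM; congr (_ * _); ring.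
Qed.

Lemma coef_law_pmf (k : 'I_n.+2) : pmf X k%:R = a k / F.
Proof.
have le_kn : (k <= n.+1)%N by rewrite -ltnS.
rewrite (lawX.2 k le_kn) A_coef -sum_a big_mkord; congr (_ / _).
by apply: eq_bigr => j _; rewrite A_coef.
Qed.

Lemma coef_law_mean : mean X = n.+1%:R * L / (5 * F) + 2 / 5.
Proof.
rewrite (mean_finite_support lawX.1).
under eq_bigr do rewrite coef_law_pmf mulrA.
by rewrite -mulr_suml sum_id_a; field; rewrite gt_eqF.
Qed.

Lemma coef_law_total_variance :
  \sum_(k < n.+2) (k%:R - mean X) ^+ 2 * a k = stddev X ^+ 2 * F.
Proof.
rewrite (stddev_finite_support lawX.1) mulr_suml.
by apply: eq_bigr => k _; rewrite coef_law_pmf mulrA divfK // gt_eqF.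
Qed.

(** The identity 5 E[X^2] - 6 E[X] + 2 = n^2, with the value of the mean
    inserted and L^2 eliminated through L^2 = 5 F^2 + 4. *)
Lemma coef_law_variance :
  25 * stddev X ^+ 2 = 2 * n.+1%:R * (L / F) - 2 - 4 * (n.+1%:R / F) ^+ 2.
Proof.
have F0 : F != 0 by rewrite gt_eqF.
apply: (mulIf F0); rewrite -[LHS]mulrA -coef_law_total_variance.
set m := mean X.
have -> : \sum_(k < n.+2) (k%:R - m) ^+ 2 * a k =
    (n.+1%:R ^+ 2 * F + (6 - 10 * m) * ((n.+1%:R * L + 2 * F) / 5)
     + (5 * m ^+ 2 - 2) * F) / 5.
  rewrite -sum_quadratic_a -sum_id_a -[in X in _ + X]sum_a.
  rewrite !mulr_sumr -!big_split mulr_suml /=.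
  by apply: eq_bigr => k _; field.
rewrite /m coef_law_mean.
have L2 : L ^+ 2 = 5 * F ^+ 2 + 4.
  have := congr1 (intmul (1 : R)) (lucas_even_sqr n.+1).
  by rewrite rmorphXn => ->; rewrite /F; ring.
apply/eqP; rewrite -subr_eq0; apply/eqP.
transitivity (n.+1%:R ^+ 2 * (5 * F ^+ 2 + 4 - L ^+ 2) / F); last first.
  by rewrite L2 subrr mulr0 mul0r.
field; exact: F0.
Qed.

End CoefLaw.

Section Asymptotics.
Context {R : realType} {d : measure_display} {T : measurableType d}.
Context {P : probability T R} {X : {RV P >-> R}} {n : nat}.
Context (lawX : has_coef_law X n.+1).

(** (n + 1) / sqrt 5, near which the ratio of consecutive coefficients is 1. *)
Let tau : R := Num.sqrt 5 * n.+1%:R / 5.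
Let F : R := (fib (2 * n.+1))%:R.

Let F_ge : n.+1%:R <= F.
Proof. by rewrite ler_nat fib_even_ge. Qed.

(** With N = n + 1: N (L/F - sqrt 5) <= N / F^2 <= 1 because F >= N. *)
Let ratio_excess : 0 <= n.+1%:R * ((lucas_even n.+1)%:~R / F) - 5 * tau <= 1.
Proof.
have n1 : 1 <= n.+1%:R :> R by rewrite ler1n.
have F0 : 0 < F := lt_le_trans (lt_le_trans ltr01 n1) F_ge.
have /andP[r1 r2] := @lucas_fib_ratio R n.
have -> : 5 * tau = n.+1%:R * Num.sqrt 5 by rewrite /tau; field.
rewrite -mulrBr mulr_ge0 ?subr_ge0 ?r1 //=.
apply: (@le_trans _ _ (n.+1%:R * (F ^+ 2)^-1)).
  by rewrite ler_wpM2l // lerBlDl.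
rewrite ler_pdivrMr ?exprn_gt0 // mul1r expr2.
by apply: le_trans F_ge _; rewrite ler_peMl ?(ltW F0) // (le_trans n1).
Qed.

Lemma coef_law_mean_close : `|mean X - tau| <= 1.
Proof.
have n1 : 1 <= n.+1%:R :> R by rewrite ler1n.
have F0 : 0 < F := lt_le_trans (lt_le_trans ltr01 n1) F_ge.
have /andP[r1 r2] := ratio_excess.
rewrite (coef_law_mean lawX) -/F.
have -> : n.+1%:R * (lucas_even n.+1)%:~R / (5 * F) + 2 / 5 - tau =
    (n.+1%:R * ((lucas_even n.+1)%:~R / F) - 5 * tau) / 5 + 2 / 5.
  by field; rewrite gt_eqF.
by rewrite ler_norml; apply/andP; split; lra.
Qed.

Lemma coef_law_variance_close : `|stddev X ^+ 2 - 2 / 5 * tau| <= 1.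
Proof.
have n1 : 1 <= n.+1%:R :> R by rewrite ler1n.
have F0 : 0 < F := lt_le_trans (lt_le_trans ltr01 n1) F_ge.
have /andP[r1 r2] := ratio_excess.
have v := coef_law_variance lawX; rewrite -/F in v.
have q0 : 0 <= (n.+1%:R / F) ^+ 2 <= 1.
  by rewrite sqr_ge0 expr_le1 ?divr_ge0 ?(ltW F0) // ler_pdivrMr // mul1r.
have /andP[q1 q2] := q0.
rewrite -mulrA in v.
by rewrite ler_norml; apply/andP; split; lra.
Qed.

End Asymptotics.

(** * Riemann sums of the Gaussian *)

Section GaussianRiemannSum.
Context {R : realType}.
Implicit Types x y s : R.

Local Notation I := (@gauss_integral_proof.integral0_gauss R).
Local Notation g := (@gauss_fun R).

Lemma gauss_fun_decr x y : 0 <= x -> x <= y -> g y <= g x.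
Proof.
by move=> x0 xy; rewrite ler_expR lerN2 ler_pXn2r // nnegrE // (le_trans x0).
Qed.

(** Mean value theorem for the primitive [I] of the decreasing function [g]. *)
Lemma integral0_gauss_step x y : 0 <= x -> x <= y ->
  (y - x) * g y <= I y - I x <= (y - x) * g x.
Proof.
move=> x0 xy.
have intg u : lebesgue_measure.-integrable `[0, u] (EFin \o g).
  apply: continuous_compact_integrable => //; first exact: segment_compact.
  by apply: continuous_subspaceT; exact: continuous_gauss_fun.
have derI z : z \in `]x, y[ -> is_derive z 1 I (g z).
  rewrite in_itv /= => /andP[xz zy].
  have [||dI <-] := @continuous_FTC1 R g (BLeft 0) z y zy (intg y).
  - by rewrite /= lte_fin (le_lt_trans x0).
  - exact: continuous_gauss_fun.
  by rewrite derive1E; exact: derivableP.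
have ctsI : {within `[x, y], continuous I}.
  apply: (@continuous_subspaceW _ _ _ `[0, y]).
    by apply: subset_itvr; rewrite bnd_simp.
  exact: parameterized_integral_continuous (le_trans x0 xy) (intg y).
have [z zxy ->] := MVT_segment xy derI ctsI.
move: zxy; rewrite in_itv /= => /andP[xz zy].
have z0 := le_trans x0 xz.
by rewrite [g z * _]mulrC !ler_wpM2l ?subr_ge0 ?gauss_fun_decr.
Qed.

Lemma integral0_gauss0 : I 0 = 0.
Proof. by rewrite /gauss_integral_proof.integral0_gauss set_itv1 Rintegral_set1. Qed.

Lemma integral0_gauss_nondecr x y : 0 <= x -> x <= y -> I x <= I y.
Proof.
move=> x0 xy; have /andP[+ _] := integral0_gauss_step x y x0 xy.
by rewrite -subr_ge0; apply: le_trans; rewrite mulr_ge0 ?subr_ge0 ?gauss_fun_ge0.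
Qed.

(** Half of the Gaussian integral, as a limit of the primitive. *)
Lemma cvg_integral0_gauss : I x @[x --> +oo] --> Num.sqrt pi / 2.
Proof.
have : Num.sqrt (I x ^+ 2) @[x --> +oo] --> Num.sqrt (pi / 4 : R).
  apply: continuous_cvg; first exact: sqrt_continuous.
  exact: gauss_integral_proof.cvg_integral0_gauss_sqr.
have -> : pi / 4 = (Num.sqrt pi / 2) ^+ 2 :> R.
  by rewrite exprMn sqr_sqrtr ?pi_ge0 //; field.
rewrite sqrtr_sqr ger0_norm ?divr_ge0 ?sqrtr_ge0 //.
apply: cvg_trans; apply: near_eq_cvg; near=> x.
by rewrite sqrtr_sqr ger0_norm // gauss_integral_proof.integral0_gauss_ge0.
Unshelve. end_near. Qed.

Lemma integral0_gauss_le x : 0 <= x -> I x <= Num.sqrt pi / 2.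
Proof.
move=> x0; apply: (cvgr_to_ge cvg_integral0_gauss).
near=> y; apply: integral0_gauss_nondecr => //.
Unshelve. all: end_near. Qed.

(** The first term is at most s.  Each later term is taken at the right end of
    its step, where [g] is smallest, so together they stay below the integral. *)
Lemma gauss_riemann_sum_le s y m : 0 <= y -> 0 <= s ->
  s * \sum_(j < m) g (y + j%:R * s) <= s + Num.sqrt pi / 2.
Proof.
move=> y0 s0.
have pos j : 0 <= y + j%:R * s by rewrite addr_ge0 // mulr_ge0.
case: m => [|m].
  by rewrite big_ord0 mulr0 addr_ge0 // divr_ge0 ?sqrtr_ge0.
have H : s * \sum_(j < m.+1) g (y + j%:R * s) <= s + I (y + m%:R * s).
  elim: m => [|m IHm].
    rewrite big_ord1 ler_wpDr ?gauss_integral_proof.integral0_gauss_ge0 //.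
    by rewrite ler_piMr ?gauss_fun_le1.
  rewrite big_ord_recr mulrDr /=.
  have := integral0_gauss_step (y + m%:R * s) (y + m.+1%:R * s) (pos _).
  rewrite lerD2l ler_wpM2r ?ler_nat // => /(_ isT) /andP[+ _].
  have -> : y + m.+1%:R * s - (y + m%:R * s) = s by rewrite -natr1; ring.
  lra.
by apply: (le_trans H); rewrite lerD2l integral0_gauss_le.
Qed.

(** Left end points overestimate the integral from y on, and the part of the
    integral over [0, y] that is missed is at most y <= s. *)
Lemma gauss_riemann_sum_ge s y m : 0 <= y <= s ->
  I (m%:R * s) - s <= s * \sum_(j < m) g (y + j%:R * s).
Proof.
move=> /andP[y0 ys]; have s0 := le_trans y0 ys.
have pos j : 0 <= y + j%:R * s by rewrite addr_ge0 // mulr_ge0.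
have H : I (y + m%:R * s) - I y <= s * \sum_(j < m) g (y + j%:R * s).
  elim: m => [|m IHm]; first by rewrite big_ord0 mul0r addr0 subrr mulr0.
  rewrite big_ord_recr mulrDr /=.
  have := integral0_gauss_step (y + m%:R * s) (y + m.+1%:R * s) (pos _).
  rewrite lerD2l ler_wpM2r ?ler_nat // => /(_ isT) /andP[_].
  have -> : y + m.+1%:R * s - (y + m%:R * s) = s by rewrite -natr1; ring.
  lra.
apply: le_trans H; apply: lerB.
  by apply: integral0_gauss_nondecr; rewrite ?mulr_ge0 // lerDr.
have /andP[_] := integral0_gauss_step 0 y (lexx _) y0.
rewrite integral0_gauss0 !subr0 => /le_trans; apply; apply: le_trans ys.
by rewrite ler_piMr ?gauss_fun_le1.
Qed.

End GaussianRiemannSum.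

Local Notation I := gauss_integral_proof.integral0_gauss.

(** * A local limit theorem from ratios of consecutive terms *)

Lemma phi_gt0 {R : realType} (x : R) : 0 < phi x.
Proof. by rewrite mulr_gt0 ?expR_gt0 // invr_gt0 sqrtr_gt0 mulr_gt0 ?pi_gt0. Qed.

Lemma phiE {R : realType} (x : R) :
  phi x = gauss_fun (x / Num.sqrt 2) / (Num.sqrt 2 * Num.sqrt pi).
Proof.
by rewrite /phi /gauss_fun sqrtrM // exprMn exprVn sqr_sqrtr // mulNr mulrC.
Qed.

(** Folding the window at its centre reduces sums over it to sums of the
    decreasing half of the Gaussian. *)
Lemma sum_window_centre {R : realType} (f : nat -> R) (c m : nat) : (m <= c)%N ->
  \sum_(c - m <= k < c + m) f k =
    \sum_(j < m) f (c + j)%N + \sum_(j < m) f (c - j.+1)%N.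
Proof.
elim: m => [|m IHm] le_mc; first by rewrite subn0 addn0 big_geq // !big_ord0 addr0.
rewrite !big_ord_recr /= addnS big_nat_recr; last by lia.
rewrite big_ltn; last by lia.
rewrite -subSn // subSS (IHm (ltnW le_mc)).
by rewrite /=; ring.
Qed.

(** The points (k - mu)/sigma form two arithmetic progressions leaving 0 in
    both directions, each starting within one step of 0 because mu lies in
    [c - 1, c].  The step s is scaled by sqrt 2 because [gauss_fun] is
    exp(-x^2) while [phi] decays as exp(-x^2/2). *)
Lemma phi_window_sum {R : realType} (mu sigma s : R) (c m : nat) :
  0 < sigma -> c%:R - 1 <= mu <= c%:R -> (m <= c)%N ->
  s = (sigma * Num.sqrt 2)^-1 ->
  2 / Num.sqrt pi * (I (m%:R * s) - s)
    <= \sum_(c - m <= k < c + m) phi ((k%:R - mu) / sigma) / sigma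
    <= 1 + 2 / Num.sqrt pi * s.
Proof.
move=> sigma0 /andP[muc cmu] le_mc sE; set S := \sum_(_ <= _ < _) _.
have q2 : 0 < Num.sqrt 2 :> R by rewrite sqrtr_gt0.
have qpi : 0 < Num.sqrt pi :> R by rewrite sqrtr_gt0 pi_gt0.
have s0 : 0 < s by rewrite sE invr_gt0 mulr_gt0.
have termE y : phi (y / sigma) / sigma = s / Num.sqrt pi * gauss_fun (y * s).
  rewrite phiE sE; have -> : y / sigma / Num.sqrt 2 = y * (sigma * Num.sqrt 2)^-1.
    by rewrite invfM mulrA.
  by field; rewrite !gt_eqF.
have -> : S = (s * \sum_(j < m) gauss_fun ((c%:R - mu) * s + j%:R * s) +
    s * \sum_(j < m) gauss_fun ((mu - (c%:R - 1)) * s + j%:R * s)) / Num.sqrt pi.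
  rewrite /S sum_window_centre // mulrDl.
  congr (_ + _); rewrite mulrAC mulr_sumr; apply: eq_bigr => j _.
    rewrite termE natrD; congr (_ * gauss_fun _); ring.
  have lt_jc : (j < c)%N := leq_trans (ltn_ord j) le_mc.
  rewrite termE natrB // -natr1.
  rewrite (_ : (c%:R - (j%:R + 1) - mu) * s = - ((mu - (c%:R - 1)) * s + j%:R * s)).
    by rewrite /gauss_fun sqrrN.
  by ring.
have scale t : 0 <= t <= 1 -> 0 <= t * s <= s.
  by move=> /andP[t0 t1]; rewrite mulr_ge0 ?(ltW s0) //= ler_piMl // ltW.
have y1 : 0 <= (c%:R - mu) * s <= s by apply: scale; lra.
have y2 : 0 <= (mu - (c%:R - 1)) * s <= s by apply: scale; lra.
have l1 := gauss_riemann_sum_ge s _ m y1; have l2 := gauss_riemann_sum_ge s _ m y2.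
have [y1' _] := andP y1; have [y2' _] := andP y2.
have u1 := gauss_riemann_sum_le s _ m y1' (ltW s0).
have u2 := gauss_riemann_sum_le s _ m y2' (ltW s0).
apply/andP; split.
  rewrite mulrAC ler_pM2r ?invr_gt0 //; lra.
rewrite ler_pdivrMr // (_ : _ * Num.sqrt pi = Num.sqrt pi + 2 * s).
  lra.
by field; rewrite gt_eqF.
Qed.

(** Chebyshev's inequality: outside the window |k - mu| >= m, hence
    a_k <= ((k - mu)/m)^2 a_k there. *)
Lemma chebyshev_window {R : realType} (a : nat -> R) (mu sigma F : R) (c m N : nat) :
  (forall k, 0 <= a k) -> c%:R - 1 <= mu <= c%:R ->
  (0 < m)%N -> (c + m <= N)%N ->
  \sum_(k < N) a k = F ->
  \sum_(k < N) (k%:R - mu) ^+ 2 * a k = sigma ^+ 2 * F ->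
  F * (1 - (sigma / m%:R) ^+ 2) <= \sum_(c - m <= k < c + m) a k <= F.
Proof.
move=> a0 /andP[muc cmu] m0 le_N sumF sumV.
have m0' : 0 < m%:R :> R by rewrite ltr0n.
have -> : \sum_(c - m <= k < c + m) a k =
    \sum_(k < N | (c - m <= k < c + m)%N) a k.
  rewrite (big_nat_widenl _ 0%N) // (big_nat_widen _ _ N) // big_mkord.
  by apply: eq_bigl => k; rewrite andbC.
apply/andP; split; last first.
  rewrite -sumF [leRHS](bigID (fun k : 'I_N => (c - m <= k < c + m)%N)) /=.
  by rewrite lerDl sumr_ge0.
have out (k : 'I_N) : ~~ (c - m <= k < c + m)%N ->
    a k <= (k%:R - mu) ^+ 2 * a k / m%:R ^+ 2.
  move=> outk; rewrite ler_pdivlMr ?exprn_gt0 // mulrC ler_wpM2r //.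
  have [lt_k|le_k] := ltnP k c.
    have : k%:R + m%:R + 1 <= c%:R :> R by rewrite -natrD natr1 ler_nat; lia.
    by move=> h; rewrite -[leRHS]sqrrN ler_pXn2r ?nnegrE //; lra.
  have : c%:R + m%:R <= k%:R :> R by rewrite -!natrD ler_nat; lia.
  by move=> h; rewrite ler_pXn2r ?nnegrE //; lra.
have : F <= \sum_(k < N | (c - m <= k < c + m)%N) a k +
    \sum_(k < N) (k%:R - mu) ^+ 2 * a k / m%:R ^+ 2.
  rewrite -sumF (bigID (fun k : 'I_N => (c - m <= k < c + m)%N)) /= lerD2l.
  apply: (le_trans (ler_sum _ out)).
  rewrite [leRHS](bigID (fun k : 'I_N => (c - m <= k < c + m)%N)) /=.
  rewrite lerDr sumr_ge0 // => k _.
  by rewrite divr_ge0 ?sqr_ge0 // mulr_ge0 ?sqr_ge0.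
rewrite -mulr_suml sumV exprMn exprVn => h.
by rewrite mulrBr mulr1 lerBlDr (le_trans h) // lerD2l mulrA [F * _]mulrC.
Qed.

Lemma dist_le_of_steps {R : realType} (f : nat -> R) (kappa : R) (u v i j : nat) :
  (forall k, (u <= k)%N -> (k.+1 < v)%N -> `|f k.+1 - f k| <= kappa) ->
  (u <= i < v)%N -> (u <= j < v)%N -> 0 <= kappa ->
  `|f i - f j| <= (v - u)%:R * kappa.
Proof.
move=> step + + kappa0.
wlog le_ij : i j / (i <= j)%N => [W|].
  by have [/W//|/ltnW /W W'] := leqP i j; move=> *; rewrite distrC W'.
move=> /andP[le_ui _] /andP[_ lt_jv].
have: `|f i - f j| <= (j - i)%:R * kappa.
  elim: j le_ij lt_jv => [|j IHj] le_ij lt_jv.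
    by move: le_ij; rewrite leqn0 => /eqP ->; rewrite subrr normr0 mul0r.
  move: le_ij; rewrite leq_eqVlt => /predU1P[->|].
    by rewrite subrr normr0 mulr_ge0.
  rewrite ltnS => le_ij.
  rewrite (subSn le_ij) -natr1 mulrDl mul1r.
  rewrite (_ : f i - f j.+1 = (f i - f j) - (f j.+1 - f j)); last by ring.
  apply: (le_trans (ler_normB _ _)); apply: lerD; first by rewrite IHj // ltnW.
  by apply: step => //; exact: leq_trans le_ij.
by move=> /le_trans; apply; rewrite ler_wpM2r // ler_nat; lia.
Qed.

(** If a/psi is constant on a window up to a factor 1 + eta, its value at any
    point of the window is close to the quotient of the sums of a and of psi.
    Here the sums are F and sigma, each up to a factor 1 + O(eta). *)
Lemma normalise_on_window {R : realType} (a psi : nat -> R) (F sigma eta : R)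
    (u v k0 : nat) :
  0 < F -> 0 < sigma -> 0 < eta <= 4^-1 -> (forall k, 0 < psi k) ->
  (forall k, (u <= k < v)%N -> 0 < a k) ->
  (forall k, (u <= k < v)%N ->
     `|ln (a k / psi k) - ln (a k0 / psi k0)| <= ln (1 + eta)) ->
  F * (1 - eta) <= \sum_(u <= k < v) a k <= F ->
  1 - eta <= \sum_(u <= k < v) psi k / sigma <= 1 + eta ->
  (u <= k0 < v)%N ->
  `|a k0 * sigma / (F * psi k0) - 1| <= 4 * eta.
Proof.
move=> F0 sigma0 /andP[eta0 eta1] psi0 a0 flat /andP[W1 W2] /andP[S1 S2] k0in.
set b := a k0 / psi k0 in flat; set S := \sum_(u <= k < v) psi k / sigma in S1 S2.
set W := \sum_(u <= k < v) a k in W1 W2.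
have b0 : 0 < b by rewrite divr_gt0 ?a0.
have SE : b * sigma * S = \sum_(u <= k < v) b * psi k.
  by rewrite mulr_sumr; apply: eq_bigr => k _; field; rewrite gt_eqF.
have flat' k : (u <= k < v)%N ->
    a k <= (1 + eta) * (b * psi k) /\ b * psi k <= (1 + eta) * a k.
  move=> kin; have ak0 := a0 k kin.
  have r0 : 0 < a k / psi k by rewrite divr_gt0.
  have eta10 : 0 < 1 + eta by lra.
  have rpos := mulr_gt0 r0 eta10; have bpos := mulr_gt0 b0 eta10.
  have := flat k kin; rewrite ler_distl => /andP[l1 l2].
  have h1 : a k / psi k <= b * (1 + eta).
    by rewrite -ler_ln ?posrE // [ln (b * _)]lnM ?posrE.
  have h2 : b <= a k / psi k * (1 + eta).
    by rewrite -ler_ln ?posrE // [ln (a k / psi k * _)]lnM ?posrE // -lerBlDr.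
  rewrite ler_pdivrMr // in h1.
  rewrite mulrAC ler_pdivlMr // in h2.
  by split; [rewrite mulrA [(1 + eta) * b]mulrC | rewrite [leRHS]mulrC].
have hi : W <= (1 + eta) * (b * sigma * S).
  rewrite SE mulr_sumr; apply: ler_sum_nat => k kin; exact: (flat' k kin).1.
have lo : b * sigma * S <= (1 + eta) * W.
  rewrite SE mulr_sumr; apply: ler_sum_nat => k kin; exact: (flat' k kin).2.
pose t := a k0 * sigma / (F * psi k0).
have tE : b * sigma = t * F by rewrite /b /t; field; rewrite !gt_eqF.
have t0 : 0 < t by rewrite divr_gt0 ?mulr_gt0 ?a0.
rewrite -/t ler_distl.
rewrite tE in hi lo.
have up : t * (1 - eta) <= 1 + eta.
  rewrite -(ler_pM2r F0).
  apply: (@le_trans _ _ (t * F * S)); first by rewrite mulrAC ler_wpM2l // mulr_ge0 // ltW.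
  by apply: (le_trans lo); rewrite ler_wpM2l //; lra.
have dn : 1 - eta <= t * (1 + eta) ^+ 2.
  rewrite -(ler_pM2r F0) mulrC.
  apply: (le_trans W1); apply: (le_trans hi).
  rewrite (_ : t * (1 + eta) ^+ 2 * F = (1 + eta) * (t * F * (1 + eta))); last by ring.
  rewrite ler_wpM2l //; first by lra.
  by rewrite ler_wpM2l // mulr_ge0 // ltW.
apply/andP; split.
  have pos : 0 < (1 + eta) ^+ 2 by rewrite exprn_gt0; lra.
  rewrite -(ler_pM2r pos); apply: le_trans dn.
  by nra.
have pos : 0 < 1 - eta by lra.
rewrite -(ler_pM2r pos); apply: (le_trans up).
by nra.
Qed.

Lemma window_dist {R : realType} (mu : R) (c m k : nat) :
  c%:R - 1 <= mu <= c%:R -> (c - m <= k < c + m)%N -> `|k%:R - mu| <= m%:R.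
Proof.
move=> /andP[c1 c2] kin.
have : c%:R <= k%:R + m%:R :> R by rewrite -natrD ler_nat; lia.
have : k%:R + 1 <= c%:R + m%:R :> R by rewrite -natrD natr1 ler_nat; lia.
by move=> ? ?; rewrite ler_distl; apply/andP; split; lra.
Qed.

Lemma mem_window {R : realType} (mu : R) (c m k : nat) :
  c%:R - 1 <= mu <= c%:R -> `|k%:R - mu| < m%:R -> (c - m <= k < c + m)%N.
Proof.
move=> /andP[c1 c2]; rewrite ltr_distl => /andP[h1 h2].
have : c%:R < (k + m).+1%:R :> R by rewrite -natr1 natrD; lra.
have : k%:R < (c + m)%:R :> R by rewrite natrD; lra.
by rewrite !ltr_nat; lia.
Qed.

(** Half-width just above K sigma and centre just above mu, both integers; the
    bound on mu keeps the window inside the natural numbers. *)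
Lemma exists_window {R : realType} (K sigma mu : R) :
  0 <= K -> 1 <= sigma -> (K + 1) * sigma <= mu ->
  exists c m : nat, [/\ c%:R - 1 <= mu <= c%:R, K * sigma < m%:R,
    m%:R <= (K + 1) * sigma, (0 < m)%N & (m <= c)%N].
Proof.
move=> K0 s1 mubig; have Ks0 : 0 <= K * sigma by rewrite mulr_ge0 //; lra.
have mu0 : 0 <= mu by apply: le_trans mubig; rewrite mulr_ge0 //; lra.
have /andP[c1 c2] := truncn_itv mu0; have /andP[m1 m2] := truncn_itv Ks0.
exists (Num.truncn mu).+1, (Num.truncn (K * sigma)).+1.
rewrite -natr1 in c2 *; rewrite -natr1 in m2 *; split => //.
- by apply/andP; split; lra.
- by lra.
- by rewrite -(ler_nat R) -!natr1; lra.
Qed.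

(** The estimate at one fixed n.  The hypotheses on eta, K and del come in the
    order in which these are chosen: eta is the accuracy, K makes the window
    carry all but eta of the mass of a and of the Gaussian, and del is the
    accuracy of the ratios that keeps the accumulated drift over the window
    below 1 + eta; the lower bounds on sigma say that n is large. *)
Lemma local_limit_on_window {R : realType} (a : nat -> R) (N : nat)
    (mu sigma F K eta del : R) (k0 : nat) :
  0 < eta <= 4^-1 -> 1 <= K -> K ^- 2 <= eta ->
  1 - eta / 2 <= 2 / Num.sqrt pi * I (K / Num.sqrt 2) ->
  0 < del -> 4 * (K + 1) * del <= ln (1 + eta) ->
  1 <= sigma -> (2 * del)^-1 <= sigma ->
  4 / (Num.sqrt pi * Num.sqrt 2 * eta) <= sigma ->
  (K + 1) * sigma <= mu ->
  (forall k, 0 <= a k) -> 0 < F ->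
  \sum_(k < N) a k = F ->
  \sum_(k < N) (k%:R - mu) ^+ 2 * a k = sigma ^+ 2 * F ->
  (forall k : nat, `|k%:R - mu| <= (K + 1) * sigma ->
     [/\ (k < N)%N, 0 < a k &
       `|ln (a k.+1 / a k) + (k%:R - mu) / sigma ^+ 2| <= del / sigma]) ->
  `|k0%:R - mu| <= K * sigma ->
  `|a k0 * sigma / (F * phi ((k0%:R - mu) / sigma)) - 1| <= 4 * eta.
Proof.
move=> /andP[eta0 eta1] K1 Keta KI del0 delK s1 s2 s3 mubig a0 F0 sumF sumV rat k0M.
have qpi : 0 < Num.sqrt pi :> R by rewrite sqrtr_gt0 pi_gt0.
have q2 : 0 < Num.sqrt 2 :> R by rewrite sqrtr_gt0.
have sigma0 : 0 < sigma by lra.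
have [c [m [cmu ltm lem m0 le_mc]]] :=
  exists_window K sigma mu (le_trans ler01 K1) s1 mubig.
have window (k : nat) : (c - m <= k < c + m)%N -> `|k%:R - mu| <= (K + 1) * sigma.
  by move=> /(window_dist _ _ _ _ cmu) /le_trans; apply.
have k0in := mem_window _ _ _ _ cmu (le_lt_trans k0M ltm).
pose psi (k : nat) := phi ((k%:R - mu) / sigma).
apply: (@normalise_on_window _ a psi F sigma eta (c - m) (c + m)) => //.
- by rewrite eta0.
- by move=> k; exact: phi_gt0.
- by move=> k /window /rat [].
- move=> k kin.
  have ppsi j : 0 < psi j by exact: phi_gt0.
  (* ln psi drops by (j - mu)/sigma^2 + 1/(2 sigma^2) per step; the first term
     cancels against the ratio of a up to del/sigma, and the second is at most
     del/sigma. *)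
  have step j : (c - m <= j)%N -> (j.+1 < c + m)%N ->
      `|ln (a j.+1 / psi j.+1) - ln (a j / psi j)| <= 2 * del / sigma.
    move=> l1 l2.
    have jin : (c - m <= j < c + m)%N by rewrite l1 ltnW.
    have j1in : (c - m <= j.+1 < c + m)%N by rewrite l2 andbT leqW.
    have [_ aj rj] := rat j (window j jin).
    have [_ aj1 _] := rat j.+1 (window j.+1 j1in).
    have lnpsi i : ln (psi i) = ln (Num.sqrt (2 * pi))^-1 - ((i%:R - mu) / sigma) ^+ 2 / 2.
      rewrite /psi /phi lnM ?posrE ?expR_gt0 // ?expRK ?mulNr //.
      by rewrite invr_gt0 sqrtr_gt0 mulr_gt0 ?pi_gt0.
    rewrite ln_div ?posrE // in rj; rewrite !ln_div ?posrE // !lnpsi.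
    have -> : ln (a j.+1) - (ln (Num.sqrt (2 * pi))^-1 - ((j.+1%:R - mu) / sigma) ^+ 2 / 2)
       - (ln (a j) - (ln (Num.sqrt (2 * pi))^-1 - ((j%:R - mu) / sigma) ^+ 2 / 2))
       = (ln (a j.+1) - ln (a j) + (j%:R - mu) / sigma ^+ 2) + (2 * sigma ^+ 2)^-1.
      by rewrite -[j.+1%:R]natr1; field; rewrite gt_eqF.
    apply: (le_trans (ler_normD _ _)).
    rewrite (_ : 2 * del / sigma = del / sigma + del / sigma); last by ring.
    apply: lerD => //; rewrite gtr0_norm ?invr_gt0 ?mulr_gt0 ?exprn_gt0 //.
    rewrite ler_pdivlMr // (_ : _ * sigma = (2 * sigma)^-1); last by field; rewrite gt_eqF.
    by rewrite invf_ple ?posrE ?mulr_gt0 // ; move: s2; rewrite invfM; lra.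
  have := dist_le_of_steps (fun j => ln (a j / psi j)) (2 * del / sigma)
    _ _ k k0 step kin k0in.
  move=> /(_ _)/le_trans; apply.
    by rewrite divr_ge0 ?mulr_ge0 // ltW.
  have -> : (c + m - (c - m) = 2 * m)%N by move: le_mc; clear; lia.
  rewrite mulrA ler_pdivrMr // natrM.
  apply: le_trans (ler_wpM2r (ltW sigma0) delK).
  have del40 : 0 <= 4 * del by rewrite mulr_ge0 // ltW.
  have := ler_wpM2l del40 lem.
  by congr (_ <= _); ring.
- have le_cN : (c + m <= N)%N.
    have endin : (c - m <= (c + m).-1 < c + m)%N by move: m0 le_mc; clear; lia.
    have [lt_N _ _] := rat _ (window _ endin).
    by move: m0 lt_N; clear; lia.
  have := chebyshev_window a mu sigma F c m N a0 cmu m0 le_cN sumF sumV.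
  move=> /andP[h1 ->]; rewrite andbT; apply: le_trans h1.
  rewrite ler_wpM2l ?(ltW F0) // lerD2l lerN2; apply: le_trans Keta.
  rewrite -exprVn ler_pXn2r ?nnegrE ?divr_ge0 ?invr_ge0 ?(ltW sigma0) //; last by lra.
  by rewrite ler_pdivrMr ?ltr0n // mulrC ler_pdivlMr; lra.
- have := phi_window_sum mu sigma (sigma * Num.sqrt 2)^-1 c m sigma0 cmu le_mc erefl.
  set s := (sigma * _)^-1.
  have s0 : 0 < s by rewrite invr_gt0 mulr_gt0.
  have sle : 2 / Num.sqrt pi * s <= eta / 2.
    move: s3; rewrite ler_pdivrMr ?mulr_gt0 // => s3.
    have -> : 2 / Num.sqrt pi * s = 2 / (Num.sqrt pi * (sigma * Num.sqrt 2)).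
      by rewrite /s; field; rewrite !gt_eqF.
    rewrite ler_pdivrMr ?mulr_gt0 //.
    have -> : eta / 2 * (Num.sqrt pi * (sigma * Num.sqrt 2)) =
        sigma * (Num.sqrt pi * Num.sqrt 2 * eta) / 2 by field.
    by rewrite ler_pdivlMr // -natrM.
  move=> /andP[l1 l2]; apply/andP; split; last by lra.
  apply: (le_trans _ l1); rewrite mulrBr.
  have : 2 / Num.sqrt pi * I (K / Num.sqrt 2) <= 2 / Num.sqrt pi * I (m%:R * s).
    rewrite ler_wpM2l ?divr_ge0 ?(ltW qpi) // integral0_gauss_nondecr //.
      by rewrite divr_ge0 ?(ltW q2) //; lra.
    by rewrite /s invfM mulrA ler_pM2r ?invr_gt0 // ler_pdivlMr // ltW.
  by lra.
Qed.

(** A local limit theorem from ratios: on every scale K sigma about the mean,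
    the ratio a_{k+1}/a_k has to agree with that of a Gaussian of mean mu and
    variance sigma^2 up to o(1/sigma), so that errors do not accumulate over
    O(sigma) steps.  Since mu and sigma^2 are the exact mean and variance of
    the array, Chebyshev's inequality bounds what lies outside these windows. *)
Theorem local_limit_of_ratio {R : realType} (a : nat -> nat -> R)
    (N : nat -> nat) (mu sigma F : nat -> R) :
  (forall n k, 0 <= a n k) ->
  (\forall n \near \oo, 0 < F n) ->
  (\forall n \near \oo, \sum_(k < N n) a n k = F n) ->
  (\forall n \near \oo,
     \sum_(k < N n) (k%:R - mu n) ^+ 2 * a n k = sigma n ^+ 2 * F n) ->
  (forall C, \forall n \near \oo, C <= sigma n) ->
  (forall K, \forall n \near \oo, K * sigma n <= mu n) ->
  (forall K eps, 0 < eps -> \forall n \near \oo, forall k : nat,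
     `|k%:R - mu n| <= K * sigma n ->
     [/\ (k < N n)%N, 0 < a n k &
       `|ln (a n k.+1 / a n k) + (k%:R - mu n) / sigma n ^+ 2| <= eps / sigma n]) ->
  forall M eps, 0 < eps -> \forall n \near \oo, forall k : nat,
    `|k%:R - mu n| <= M * sigma n ->
    `|a n k * sigma n / (F n * phi ((k%:R - mu n) / sigma n)) - 1| <= eps.
Proof.
move=> a0 F0 sumF sumV sigmay muy ratio M eps eps0.
have qpi : 0 < Num.sqrt pi :> R by rewrite sqrtr_gt0 pi_gt0.
have q2 : 0 < Num.sqrt 2 :> R by rewrite sqrtr_gt0.
pose eta : R := Num.min 4^-1 (eps / 4).
have eta0 : 0 < eta by rewrite lt_min invr_gt0 ltr0n divr_gt0.
have etale : 4 * eta <= eps.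
  by rewrite -ler_pdivlMl // mulrC ge_min lexx orbT.
have eta1 : eta <= 4^-1 by rewrite ge_min lexx.
have [K [K1 KM Keta KI]] : exists K, [/\ 1 <= K, M <= K, K ^- 2 <= eta &
    1 - eta / 2 <= 2 / Num.sqrt pi * I (K / Num.sqrt 2)].
  have [A [_ HA]] : \forall x \near +oo, 1 - eta / 2 <= 2 / Num.sqrt pi * I (x : R).
    have : 2 / Num.sqrt pi * I (x : R) @[x --> +oo] --> 2 / Num.sqrt pi * (Num.sqrt pi / 2).
      exact: (cvgM (cvg_cst _) cvg_integral0_gauss).
    rewrite (_ : 2 / _ * _ = 1); last by field; rewrite gt_eqF.
    move=> /cvgr_ge; apply; lra.
  pose K := Num.max (Num.max 1 M) (Num.max eta^-1 ((A + 1) * Num.sqrt 2)).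
  have K1 : 1 <= K by rewrite !le_max lexx.
  exists K; split => //; first by rewrite !le_max lexx !orbT.
    rewrite -[leRHS]invrK lef_pV2 ?posrE ?invr_gt0 ?exprn_gt0 ?(lt_le_trans _ K1) //.
    apply: (@le_trans _ _ K); first by rewrite !le_max lexx !orbT.
    by rewrite expr2 ler_peMl // (le_trans _ K1).
  apply: HA; rewrite ltr_pdivlMr //.
  apply: (@lt_le_trans _ _ ((A + 1) * Num.sqrt 2)); first by rewrite ltr_pM2r // ltrDl.
  by rewrite !le_max lexx !orbT.
(* A window has 2m <= 2 (K + 1) sigma points, and ln (a/psi) moves by at most
   2 del/sigma at each step. *)
pose del := ln (1 + eta) / (4 * (K + 1)).
have lneta : 0 < ln (1 + eta) by rewrite ln_gt0 //; lra.
have del0 : 0 < del by rewrite divr_gt0 // mulr_gt0 //; lra.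
have delK : 4 * (K + 1) * del <= ln (1 + eta).
  by rewrite /del mulrC divfK // gt_eqF // mulr_gt0 //; lra.
near=> n => k0 k0M.
have s1 : 1 <= sigma n by near: n; exact: sigmay.
apply: (le_trans _ etale).
apply: (@local_limit_on_window _ (a n) (N n) _ _ _ K _ del) => //.
- by rewrite eta0.
- by near: n; exact: sigmay.
- by near: n; exact: sigmay.
- by near: n; exact: muy.
- by near: n.
- by near: n.
- by near: n.
- by near: n; exact: ratio.
- by apply: (le_trans k0M); rewrite ler_wpM2r // (le_trans _ s1).
Unshelve. all: end_near. Qed.

(** * Ratios of consecutive coefficients *)

(** The lower bound is ln(1+z) = - ln(1 - z/(1+z)) >= z/(1+z). *)
Lemma ln1D_bounds {R : realType} (z : R) : - (2^-1) <= z ->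
  - (2 * z ^+ 2) <= ln (1 + z) - z <= 0.
Proof.
move=> z2; have z1 : 0 < 1 + z by lra.
rewrite subr_le0 le_ln1Dx ?andbT; last by lra.
have := @le_ln1Dx R (- z / (1 + z)).
rewrite (_ : 1 + - z / (1 + z) = (1 + z)^-1); last by field; rewrite gt_eqF.
rewrite lnV ?posrE // => /(_ _) h.
have {}h : - ln (1 + z) <= - z / (1 + z).
  by apply: h; rewrite ltr_pdivlMr //; lra.
have : - z / (1 + z) <= - z + 2 * z ^+ 2.
  rewrite ler_pdivrMr //.
  have : 0 <= z ^+ 2 * (1 + 2 * z) by rewrite mulr_ge0 ?sqr_ge0 //; lra.
  by rewrite (_ : (- z + 2 * z ^+ 2) * (1 + z) = - z + z ^+ 2 * (1 + 2 * z)); [lra|ring].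
by lra.
Qed.

(** With w = h/tau, numerator and denominator are 4 tau^2 (1 - u) and
    4 tau^2 (1 + v), where u = w/2 and v = 2w up to terms of order
    q = B/tau >= max(w^2, 1/tau).  So the logarithm is -u - v = -(5/2) w up to
    O(q); the condition 400 B <= tau makes |w| <= 1/20. *)
Lemma ln_ratio_close {R : realType} (B tau h : R) :
  1 <= B -> 400 * B <= tau -> h ^+ 2 <= B * tau ->
  `|ln ((5 * tau ^+ 2 - (tau + h) ^+ 2) /
        (2 * (tau + h) * (2 * (tau + h) + 1))) + 5 * h / (2 * tau)|
    <= 24 * B / tau.
Proof.
move=> B1 tauB hB.
have tau0 : 0 < tau by lra.
pose w := h / tau; pose p := tau^-1; pose q := B / tau.
have p0 : 0 < p by rewrite invr_gt0.
have pq : p <= q by rewrite /q -[p]mul1r ler_pM2r.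
have q400 : 400 * q <= 1 by rewrite /q mulrA ler_pdivrMr // mul1r.
have wq : w ^+ 2 <= q.
  rewrite /w expr_div_n ler_pdivrMr ?exprn_gt0 //.
  by rewrite (_ : q * tau ^+ 2 = B * tau) // /q; field; rewrite gt_eqF.
have w1 : -20^-1 <= w <= 20^-1.
  rewrite -ler_norml -ler_sqr ?nnegrE // real_normK ?num_real //.
  by apply: (le_trans wq); lra.
have /andP[w1l w1r] := w1.
pose u := w / 2 + w ^+ 2 / 4.
pose v := 2 * w + w ^+ 2 + p * (1 + w) / 2.
have u2 : u ^+ 2 <= q.
  have -> : u ^+ 2 = w ^+ 2 * (2^-1 + w / 4) ^+ 2 by rewrite /u; field.
  apply: le_trans wq; rewrite ler_piMr ?sqr_ge0 // expr_le1 //; lra.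
have v2 : v ^+ 2 <= 10 * q.
  have : v ^+ 2 <= 2 * (w * (2 + w)) ^+ 2 + 2 * (p * (1 + w) / 2) ^+ 2.
    rewrite -subr_ge0 (_ : _ - _ = (w * (2 + w) - p * (1 + w) / 2) ^+ 2) ?sqr_ge0 //.
    by rewrite /v; field.
  have : (w * (2 + w)) ^+ 2 <= q * (9 / 2).
    rewrite exprMn; apply: ler_pM; rewrite ?sqr_ge0 //; nra.
  have : (p * (1 + w) / 2) ^+ 2 <= q * (1 / 2).
    have : p * (1 + w) / 2 <= q by nra.
    have : 0 <= p * (1 + w) / 2 by rewrite divr_ge0 // mulr_ge0 ?ltW //; lra.
    by move=> ? ?; rewrite expr2; apply: ler_pM => //; lra.
  by lra.
have ule : u <= 2^-1 by rewrite /u; lra.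
have vge : - 2^-1 <= v.
  have : 0 <= p * (1 + w) by rewrite mulr_ge0 ?ltW //; lra.
  have := sqr_ge0 w.
  by rewrite /v; lra.
have -> : (5 * tau ^+ 2 - (tau + h) ^+ 2) / (2 * (tau + h) * (2 * (tau + h) + 1)) =
    (1 + - u) / (1 + v).
  have -> : 5 * tau ^+ 2 - (tau + h) ^+ 2 = (1 - u) * (4 * tau ^+ 2).
    by rewrite /u /w; field; rewrite gt_eqF.
  have -> : 2 * (tau + h) * (2 * (tau + h) + 1) = (1 + v) * (4 * tau ^+ 2).
    by rewrite /v /w /p; field; rewrite gt_eqF.
  rewrite -mulf_div divff ?mulr1 // mulf_neq0 // expf_neq0 // gt_eqF //.
rewrite ln_div ?posrE; try lra.
have /andP[a1 a2] : - (2 * u ^+ 2) <= ln (1 - u) + u <= 0.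
  by have := @ln1D_bounds R (- u); rewrite opprK sqrrN; apply; lra.
have /andP[b1 b2] := @ln1D_bounds R v vge.
have -> : 5 * h / (2 * tau) = 5 / 2 * w by rewrite /w; field; rewrite gt_eqF.
rewrite (_ : 24 * B / tau = 24 * q) ?ler_norml; last by rewrite /q mulrA.
have uv1 : u + v - 5 / 2 * w <= 2 * q.
  have : p * (1 + w) <= q * (21 / 20) by apply: ler_pM; lra.
  by rewrite /u /v; lra.
have uv2 : 0 <= u + v - 5 / 2 * w.
  have : 0 <= p * (1 + w) by rewrite mulr_ge0 ?ltW //; lra.
  have := sqr_ge0 w.
  by rewrite /u /v; lra.
clearbody u v q w.
by apply/andP; split; lra.
Qed.

(** The ratio estimate centred at tau with slope 5/(2 tau), moved to the centre
    mu and the slope 1/sigma^2: each change costs O(1/tau) on the scale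
    |k - mu| <= K sigma.  An error O(1/tau) is below eps/sigma for large n,
    because tau >= sigma^2. *)
Lemma ln_coef_Q_ratio_close {R : realType} (K eps tau mu sigma : R) (n k : nat) :
  let a j : R := ((Q n)`_j)%:~R in
  (0 < n)%N -> 5 * tau ^+ 2 = n%:R ^+ 2 -> 0 <= tau ->
  `|mu - tau| <= 1 -> `|sigma ^+ 2 - 2 / 5 * tau| <= 1 ->
  0 <= K -> 2 <= sigma -> 400 * (2 * K ^+ 2 + 2) <= sigma ^+ 2 ->
  24 * (2 * K ^+ 2 + 2) + 5 / 2 * (1 + K) <= eps * sigma ->
  `|k%:R - mu| <= K * sigma ->
  [/\ (k < n.+1)%N, 0 < a k &
    `|ln (a k.+1 / a k) + (k%:R - mu) / sigma ^+ 2| <= eps / sigma].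
Proof.
case: n => // n a _ tau2 tau0 mu_close var_close K0 s2 sB sC kmu.
set B := 2 * K ^+ 2 + 2 in sB sC.
have s0 : 0 < sigma by lra.
have ss0 : 0 < sigma ^+ 2 by rewrite exprn_gt0.
have s4 : 4 <= sigma ^+ 2 by rewrite expr2; nra.
have B1 : 1 <= B by rewrite /B; have := sqr_ge0 K; lra.
have /andP[v1 v2] : -1 <= sigma ^+ 2 - 2 / 5 * tau <= 1 by rewrite -ler_norml.
have st : sigma ^+ 2 <= tau by lra.
have t0 : 0 < tau by lra.
pose h := k%:R - tau.
have h2 : h ^+ 2 <= B * tau.
  have hle : `|h| <= K * sigma + 1.
    rewrite (_ : h = (k%:R - mu) + (mu - tau)); last by rewrite /h; ring.
    by apply: (le_trans (ler_normD _ _)); apply: lerD.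
  have : `|h| ^+ 2 <= (K * sigma + 1) ^+ 2.
    by rewrite ler_sqr ?nnegrE // addr_ge0 // mulr_ge0 // ltW.
  rewrite real_normK ?num_real // => /le_trans; apply.
  apply: (@le_trans _ _ (2 * K ^+ 2 * sigma ^+ 2 + 2)).
    by have := sqr_ge0 (K * sigma - 1); rewrite sqrrB sqrrD exprMn; lra.
  rewrite /B [leRHS]mulrDl; apply: lerD; last by lra.
  by rewrite ler_wpM2l // mulr_ge0 ?sqr_ge0.
have tB : 400 * B <= tau by apply: le_trans st.
have h20 : `|h| <= tau / 20.
  rewrite -ler_sqr ?nnegrE ?divr_ge0 // real_normK ?num_real //.
  apply: (le_trans h2); rewrite expr_div_n ler_pdivlMr ?exprn_gt0 //.
  rewrite [tau ^+ 2]expr2 mulrAC ler_wpM2r //.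
  by apply: le_trans tB; rewrite expr2; lra.
have [k1 k2] : tau * (19 / 20) <= k%:R /\ k%:R <= tau * (21 / 20).
  by move: h20; rewrite ler_norml /h => /andP[? ?]; split; lra.
have k0 : (0 < k)%N by rewrite -(ltr0n R); lra.
have kn : (k <= n.+1)%N.
  rewrite -(ler_nat R) -ler_sqr ?nnegrE // -tau2.
  have kk : k%:R ^+ 2 <= (tau * (21 / 20)) ^+ 2 by rewrite ler_sqr ?nnegrE ?mulr_ge0.
  apply: (le_trans kk); rewrite exprMn mulrC ler_wpM2r ?sqr_ge0 //.
  by rewrite expr2; lra.
have ak : 0 < a k by rewrite ltr0z coef_Q_gt0 // k0.
split => //.
have -> : a k.+1 / a k = (5 * tau ^+ 2 - (tau + h) ^+ 2) /
        (2 * (tau + h) * (2 * (tau + h) + 1)).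
  have th : tau + h = k%:R by rewrite /h; ring.
  have k0R : 0 < k%:R :> R by rewrite ltr0n.
  have r : (2 * k%:R) * (2 * k%:R + 1) * a k.+1 = (n.+1%:R ^+ 2 - k%:R ^+ 2) * a k.
    have := congr1 (intmul (1 : R)) (ratio_coef_Q n k).
    rewrite rmorphM [X in _ = X -> _]rmorphM /= => e.
    rewrite /a (_ : (2 * k%:R) * _ = ((2 * k * (2 * k).+1)%N%:Z)%:~R); last by ring.
    by rewrite e; congr (_ * _); ring.
  have den0 : 2 * k%:R * (2 * k%:R + 1) != 0 :> R.
    by rewrite gt_eqF // !mulr_gt0 // addr_gt0 // mulr_gt0.
  rewrite th tau2; apply/eqP; rewrite eqr_div ?(gt_eqF ak) //.
  by apply/eqP; rewrite mulrC r.
have est := @ln_ratio_close R B tau h B1 tB h2.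
set l := ln _ in est *.
have -> : l + (k%:R - mu) / sigma ^+ 2 = (l + 5 * h / (2 * tau)) +
    (- (5 / 2 * (mu - tau) / tau)
     - (k%:R - mu) * (5 * sigma ^+ 2 - 2 * tau) / (2 * tau * sigma ^+ 2)).
  by rewrite /h; field; rewrite !gt_eqF.
apply: (le_trans (ler_normD _ _)).
apply: (@le_trans _ _ (24 * B / tau + 5 / 2 * (1 + K) / tau)); last first.
  rewrite -mulrDl; apply: (@le_trans _ _ (eps * sigma / tau)).
    by rewrite ler_wpM2r // invr_ge0.
  have es0 : 0 <= eps * sigma by lra.
  apply: (@le_trans _ _ (eps * sigma / sigma ^+ 2)).
    by rewrite ler_wpM2l // lef_pV2 ?posrE.
  by rewrite le_eqVlt; apply/orP; left; apply/eqP; field; rewrite gt_eqF.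
apply: lerD => //.
apply: (le_trans (ler_normB _ _)); rewrite normrN.
rewrite (_ : 5 / 2 * (1 + K) / tau = 5 / 2 / tau + 5 / 2 * K / tau); last by ring.
apply: lerD.
  rewrite normrM [`|tau^-1|]gtr0_norm ?invr_gt0 // ler_wpM2r ?invr_ge0 //.
  by rewrite normrM gtr0_norm //; lra.
rewrite normrM [`|(_ * _)^-1|]gtr0_norm ?invr_gt0 ?mulr_gt0 // normrM.
have v3 : `|5 * sigma ^+ 2 - 2 * tau| <= 5.
  by rewrite ler_norml; apply/andP; split; lra.
apply: (@le_trans _ _ (K * sigma * 5 / (2 * tau * sigma ^+ 2))).
  apply: ler_wpM2r; last exact: ler_pM.
  by rewrite invr_ge0 mulr_ge0 ?sqr_ge0 ?mulr_ge0.
have -> : K * sigma * 5 / (2 * tau * sigma ^+ 2) = 5 / 2 * K / tau / sigma.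
  by field; rewrite !gt_eqF.
by rewrite ler_piMr ?divr_ge0 ?mulr_ge0 // invf_le1 //; lra.
Qed.

(** * The local limit theorem for the coefficients *)

Theorem corollary1p11 (R : realType)
  (d : nat -> measure_display)
  (T : forall n : nat, measurableType (d n))
  (P : forall n : nat, probability (T n) R)
  (X : forall n : nat, {RV (P n) >-> R})
  (HX : forall n : nat, (1 <= n)%N -> has_coef_law (X n) n)
  (k : nat -> int) (x : nat -> R)
  (Hx : forall n : nat, (2 <= n)%N ->
     x n = ((k n)%:~R - mean (X n)) / stddev (X n))
  (Hbounded : exists M : R, forall n : nat, (2 <= n)%N -> `|x n| <= M) :
  ((A n (k n))%:~R * stddev (X n)) / ((fib (2 * n))%:R * phi (x n))
    @[n --> \oo] --> (1 : R).
Proof.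
pose tau n : R := Num.sqrt 5 * n%:R / 5.
pose mu n := mean (X n); pose sigma n := stddev (X n).
have /andP[q2 _] := @sqrt5_bounds R.
have tau0 n : 0 <= tau n by rewrite !mulr_ge0.
have tau2 n : 5 * tau n ^+ 2 = n%:R ^+ 2.
  by rewrite /tau expr_div_n exprMn sqr_sqrtr //; field.
have mu_close n : `|mu n.+1 - tau n.+1| <= 1 by exact: coef_law_mean_close (HX _ _).
have var_close n : `|sigma n.+1 ^+ 2 - 2 / 5 * tau n.+1| <= 1.
  exact: coef_law_variance_close (HX _ _).
have succ (Pr : nat -> Prop) : (forall n, Pr n.+1) -> \forall n \near \oo, Pr n.
  by move=> PrS; exists 1%N => // -[].
have sigmay C : \forall n \near \oo, C <= sigma n.
  near=> n.
  have : 25 / 4 * (C ^+ 2 + 1) <= n%:R by near: n; exact: nbhs_infty_ger.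
  have : `|sigma n ^+ 2 - 2 / 5 * tau n| <= 1 by near: n; exact: succ.
  rewrite ler_norml => /andP[v1 _] nC.
  have tn : 2 / 5 * n%:R <= tau n by rewrite /tau [leRHS]mulrAC ler_wpM2r //; lra.
  apply: (le_trans (ler_norm C)); rewrite -ler_sqr ?nnegrE ?sqrtr_ge0 //.
  by rewrite real_normK ?num_real //; lra.
have sigma_tau : \forall n \near \oo, sigma n ^+ 2 <= tau n.
  near=> n.
  have s2 : 2 <= sigma n by near: n; exact: sigmay.
  have : `|sigma n ^+ 2 - 2 / 5 * tau n| <= 1 by near: n; exact: succ.
  rewrite ler_norml => /andP[_ v2].
  have : 4 <= sigma n ^+ 2 by rewrite expr2; nra.
  lra.
have muy K : \forall n \near \oo, K * sigma n <= mu n.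
  near=> n.
  have s1 : 1 <= sigma n by near: n; exact: sigmay.
  have sK : K + 1 <= sigma n by near: n; exact: sigmay.
  have st : sigma n ^+ 2 <= tau n by near: n.
  have : `|mu n - tau n| <= 1 by near: n; exact: succ.
  rewrite ler_norml => /andP[m1 _].
  have : (K + 1) * sigma n <= sigma n ^+ 2 by rewrite expr2 ler_wpM2r // (le_trans ler01).
  lra.
have [M boundM] := Hbounded.
pose a n j : R := ((Q n)`_j)%:~R.
have limit := @local_limit_of_ratio R a S mu sigma (fun n => (fib (2 * n))%:R).
apply/cvgrPdist_le => /= eps eps0.
have {}limit : \forall n \near \oo, forall j : nat,
    `|j%:R - mu n| <= M * sigma n ->
    `|a n j * sigma n / ((fib (2 * n))%:R * phi ((j%:R - mu n) / sigma n)) - 1| <= eps.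
  apply: limit => //.
  - by move=> n j; rewrite ler0z coef_Q_ge0.
  - by apply: succ => n; rewrite ltr0n (leq_trans _ (fib_even_ge _)).
  - by apply: succ => n; rewrite -[RHS]/((fib _)%:Z%:~R) -sum_coef_Q rmorph_sum.
  - by apply: succ => n; exact: coef_law_total_variance (HX _ _).
  move=> K e e0; near=> n => j jmu.
  have K0 : 0 <= `|K| by [].
  have n0 : (0 < n)%N by near: n; exact: nbhs_infty_gt.
  have s2 : 2 <= sigma n by near: n; exact: sigmay.
  have sB : 400 * (2 * `|K| ^+ 2 + 2) <= sigma n.
    by near: n; exact: sigmay.
  have sC : (24 * (2 * `|K| ^+ 2 + 2) + 5 / 2 * (1 + `|K|)) / e <= sigma n.
    by near: n; exact: sigmay.
  rewrite ler_pdivrMr // [leRHS]mulrC in sC.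
  apply: (ln_coef_Q_ratio_close `|K| e (tau n)) => //.
  - by near: n; exact: succ.
  - by near: n; exact: succ.
  - by apply: (le_trans sB); rewrite expr2 ler_peMl //; lra.
  - by apply: (le_trans jmu); rewrite ler_wpM2r ?ler_norm //; lra.
near=> n.
have n2 : (2 <= n)%N by near: n; exact: nbhs_infty_ge.
have s1 : 1 <= sigma n by near: n; exact: sigmay.
have muM : M * sigma n <= mu n by near: n; exact: muy.
have s0 : 0 < sigma n by lra.
have xn := Hx n n2; rewrite -/(mu n) -/(sigma n) in xn *.
have kM : `|(k n)%:~R - mu n| <= M * sigma n.
  have := boundM n n2; rewrite xn normrM [`|_^-1|]gtr0_norm ?invr_gt0 //.
  by rewrite ler_pdivrMr.
have k0 : 0 <= k n.
  rewrite -(ler0z R); move: kM; rewrite ler_norml => /andP[+ _]; lra.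
have lim_n : forall j : nat, `|j%:R - mu n| <= M * sigma n ->
    `|a n j * sigma n / ((fib (2 * n))%:R * phi ((j%:R - mu n) / sigma n)) - 1|
      <= eps by near: n.
have [j kj] : exists j : nat, k n = j%:Z by exists `|k n|%N; rewrite gez0_abs.
have An : A n (k n) = (Q n)`_j by rewrite kj; case: (n) n2 => // m _; rewrite A_coef.
rewrite distrC An xn kj; rewrite kj in kM.
by apply: lim_n.
Unshelve. all: end_near. Qed.
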